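(* Let $(\Omega,\mathcal{H},\hat{E})$ be a sublinear expectation space and let $\{Y_i\}_{i=1}^{\infty}$ be a sequence of $\mathbb{R}^d$-valued random variables in it satisfying the following conditions: (i) for every $i\ge1$, $Y_{i+1}$ is independent from $(Y_1,\ldots,Y_i)$; (ii) there exists a constant $M>0$ such that $\hat{E}[|Y_i|^2]\le M$ for all $i\ge1$; (iii) there exist a sequence $\{a_n\}$ of positive numbers and a sub-additive, positively homogeneous function $g:\mathbb{R}^d\to\mathbb{R}$ such that $\lim_{n\to\infty}(a_1+\cdots+a_n)/n=0$ and $$|g_n(p)-g(p)|\le a_n|p|\quad\text{for all } n\ge1,\ p\in\mathbb{R}^d,$$ where $g_i:\mathbb{R}^d\to\mathbb{R}$, $g_i(p)=\hat{E}[\langle Y_i,p\rangle]$. Let $S_n=Y_1+\cdots+Y_n$. Then $\{S_n/n\}_{n=1}^\infty$ converges in law to the maximal distribution $N(\Gamma;0)$, i.e. $$\lim_{n\to\infty}\hat{E}\left[\varphi\left(\frac{S_n}{n}\right)\right]=\hat{E}[\varphi(\eta)]\quad\text{for all }\varphi\in C_{b,Lip}(\mathbb{R}^d),$$ where $\eta\sim N(\Gamma;0)$ and $\Gamma\subset\mathbb{R}^d$ is the bounded, convex and closed set with $g(p)=\sup_{q\in\Gamma}\langle p,q\rangle$ for all $p\in\mathbb{R}^d$.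
   Context: Sublinear expectation space: $\Omega$ is a set and $\mathcal{H}$ is a linear space of real functions on $\Omega$ containing the constants, closed under $X\mapsto|X|$, and such that $\varphi(X_1,\ldots,X_n)\in\mathcal{H}$ whenever $X_1,\ldots,X_n\in\mathcal{H}$ and $\varphi\in C_{l,Lip}(\mathbb{R}^n)$. Here $C_{l,Lip}(\mathbb{R}^n)$ is the space of $\varphi:\mathbb{R}^n\to\mathbb{R}$ with $|\varphi(x)-\varphi(y)|\le C(1+|x|^m+|y|^m)|x-y|$ for all $x,y$, for some $C>0$, $m\in\mathbb{N}$ depending on $\varphi$; $C_{b,Lip}(\mathbb{R}^n)$ is the space of bounded Lipschitz functions. A sublinear expectation is a functional $\hat{E}:\mathcal{H}\to\mathbb{R}$ that is monotone ($X\ge Y\Rightarrow\hat{E}[X]\ge\hat{E}[Y]$), constant preserving ($\hat{E}[c]=c$), sub-additive ($\hat{E}[X+Y]\le\hat{E}[X]+\hat{E}[Y]$) and positively homogeneous ($\hat{E}[\lambda X]=\lambda\hat{E}[X]$, $\lambda\ge0$). An $\mathbb{R}^d$-valued random variable is an element of $\mathcal{H}^d$. Independence: $Y\in\mathcal{H}^n$ is independent from $X\in\mathcal{H}^m$ if $\hat{E}[\varphi(X,Y)]=\hat{E}\big[\hat{E}[\varphi(x,Y)]|_{x=X}\big]$ for all $\varphi\in C_{l,Lip}(\mathbb{R}^{n+m})$. Maximal distribution: for a (nonempty) bounded, convex and closed $\Gamma\subset\mathbb{R}^d$, a $d$-dimensional random vector $\eta$ is maximal distributed, $\eta\sim N(\Gamma;0)$,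 if $\hat{E}[\varphi(\eta)]=\max_{y\in\Gamma}\varphi(y)$ for all $\varphi\in C_{b,Lip}(\mathbb{R}^d)$. The vector $\eta$ may live on another sublinear expectation space, whose expectation is still denoted $\hat{E}$. *)

(* Defs.v *)
From HB Require Import structures.
From mathcomp Require Import all_boot all_order all_algebra.
From mathcomp Require Import all_classical all_reals all_analysis.
Set Implicit Arguments.
Unset Strict Implicit.
Unset Printing Implicit Defensive.
Import Order.TTheory GRing.Theory Num.Theory.
Import numFieldNormedType.Exports.
Local Open Scope classical_set_scope.
Local Open Scope ring_scope.

Definition dotv (R : realType) (n : nat) (x y : 'rV[R]_n) : R :=
  \sum_(i < n) x 0 i * y 0 i.

(* The Euclidean norm; the library norm `|x| on 'rV[R]_n is the sup norm,
   which induces the same topology and the same bounded sets. *)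
Definition enorm (R : realType) (n : nat) (x : 'rV[R]_n) : R :=
  Num.sqrt (dotv x x).

Definition C_l_Lip (R : realType) (n : nat) (phi : 'rV[R]_n -> R) : Prop :=
  exists2 C : R, 0 < C & exists m : nat, forall x y : 'rV[R]_n,
    `|phi x - phi y| <= C * (1 + enorm x ^+ m + enorm y ^+ m) * enorm (x - y).

Definition C_b_Lip (R : realType) (n : nat) (phi : 'rV[R]_n -> R) : Prop :=
  (exists K : R, forall x : 'rV[R]_n, `|phi x| <= K) /\
  (exists L : R, forall x y : 'rV[R]_n, `|phi x - phi y| <= L * enorm (x - y)).

Definition random_vector (R : realType) (Omega : Type) (H : set (Omega -> R))
    (n : nat) (X : Omega -> 'rV[R]_n) : Prop :=
  forall i : 'I_n, H (fun w => X w 0 i).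

Record random_variable_space (R : realType) (Omega : Type)
    (H : set (Omega -> R)) : Prop := RandomVariableSpace {
  rvs_cst : forall c : R, H (fun=> c);
  rvs_add : forall X Y : Omega -> R, H X -> H Y -> H (fun w => X w + Y w);
  rvs_scale : forall (c : R) (X : Omega -> R), H X -> H (fun w => c * X w);
  rvs_abs : forall X : Omega -> R, H X -> H (fun w => `|X w|);
  rvs_comp : forall (n : nat) (X : Omega -> 'rV[R]_n) (phi : 'rV[R]_n -> R),
    random_vector H X -> C_l_Lip phi -> H (fun w => phi (X w)) }.

(* E is a total function on Omega -> R, but it represents a functional on H:
   its values outside H are unconstrained and never used. *)
Record sublinear_expectation_space (R : realType) (Omega : Type)
    (H : set (Omega -> R)) (E : (Omega -> R) -> R) : Prop :=
  SublinearExpectationSpace {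
  ses_space : random_variable_space H;
  ses_mono : forall X Y : Omega -> R, H X -> H Y ->
    (forall w, Y w <= X w) -> E Y <= E X;
  ses_cst : forall c : R, E (fun=> c) = c;
  ses_subadd : forall X Y : Omega -> R, H X -> H Y ->
    E (fun w => X w + Y w) <= E X + E Y;
  ses_poshom : forall (c : R) (X : Omega -> R), 0 <= c -> H X ->
    E (fun w => c * X w) = c * E X }.

(* Y is independent from X (the notion is not symmetric). *)
Definition independent_from (R : realType) (Omega : Type)
    (E : (Omega -> R) -> R) (m n : nat)
    (Y : Omega -> 'rV[R]_n) (X : Omega -> 'rV[R]_m) : Prop :=
  forall phi : 'rV[R]_(m + n) -> R, C_l_Lip phi ->
    E (fun w => phi (row_mx (X w) (Y w))) =
    E (fun w => E (fun w' => phi (row_mx (X w) (Y w')))).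

(* The concatenation (Y_0, ..., Y_{n-1}) of n vectors of size d. *)
Definition concat_vectors (R : realType) (Omega : Type) (d : nat)
    (Y : nat -> Omega -> 'rV[R]_d) (n : nat) : Omega -> 'rV[R]_(n * d) :=
  fun w => mxvec (\matrix_(i < n) Y i w).

Definition sublinear_fun (R : realType) (d : nat) (g : 'rV[R]_d -> R) : Prop :=
  (forall p q : 'rV[R]_d, g (p + q) <= g p + g q) /\
  (forall (c : R) (p : 'rV[R]_d), 0 <= c -> g (c *: p) = c * g p).

Definition bounded_convex_closed (R : realType) (d : nat)
    (Gamma : set 'rV[R]_d) : Prop :=
  [/\ Gamma !=set0, bounded_set Gamma, convex_set Gamma & closed Gamma].

Definition is_max (R : realType) (A : set R) (v : R) : Prop :=
  A v /\ ubound A v.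

Definition maximal_distributed (R : realType) (Omega : Type)
    (E : (Omega -> R) -> R) (d : nat) (Gamma : set 'rV[R]_d)
    (eta : Omega -> 'rV[R]_d) : Prop :=
  forall phi : 'rV[R]_d -> R, C_b_Lip phi ->
    is_max (phi @` Gamma) (E (fun w => phi (eta w))).

Definition represents (R : realType) (d : nat) (g : 'rV[R]_d -> R)
    (Gamma : set 'rV[R]_d) : Prop :=
  bounded_convex_closed Gamma /\
  forall p : 'rV[R]_d, g p = sup [set dotv p q | q in Gamma].

(* Main.v *)
(* Put [D k s = dist (s, k Gamma) ^ 2]. Let [P] project [s] on [k Gamma] and let
   [q] in [Gamma] maximize [<s - P, q>], so that [<s - P, q> = g (s - P)]. By
   convexity [P + q] lies in [(k + 1) Gamma], hence
   [D (k + 1) (s + y) <= |s - P|^2 + 2 (<s - P, y> - g (s - P)) + |y - q|^2].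
   Taking expectations, independence gives
   [E D(k+1)(S_(k+1)) <= E D(k)(S_k) + 2 a_k E (dist (S_k, k Gamma)) + C].
   As [E (dist (S_k, k Gamma)) = O(k)], summation gives
   [E D(n)(S_n) = O(n + n (a_1 + ... + a_n)) = o(n^2)], which is the upper bound
   for [E (phi (S_n / n))]. For the lower bound, expand
   [E (- |S_k - k q|^2)] in the same way at a maximizer [q] of [phi] on [Gamma],
   using [g (- z) >= <- z, q>]. *)

Require Import Defs.
From mathcomp Require Import all_boot all_order all_algebra.
From mathcomp Require Import all_classical all_reals all_analysis.
From mathcomp Require Import ring lra.
Import Order.TTheory GRing.Theory Num.Theory.
Import numFieldNormedType.Exports.
Local Open Scope classical_set_scope.
Local Open Scope ring_scope.

(** * Euclidean inner product and norm *)

Lemma dotvC {R : realType} {n : nat} (x y : 'rV[R]_n) : dotv x y = dotv y x.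
Proof. by apply: eq_bigr => i _; rewrite mulrC. Qed.

Lemma dotvDr {R : realType} {n : nat} (x y z : 'rV[R]_n) :
  dotv x (y + z) = dotv x y + dotv x z.
Proof. by rewrite -big_split; apply: eq_bigr => i _; rewrite mxE mulrDr. Qed.

Lemma dotvDl {R : realType} {n : nat} (x y z : 'rV[R]_n) :
  dotv (y + z) x = dotv y x + dotv z x.
Proof. by rewrite !(dotvC _ x) dotvDr. Qed.

Lemma dotvZr {R : realType} {n : nat} (c : R) (x y : 'rV[R]_n) :
  dotv x (c *: y) = c * dotv x y.
Proof. by rewrite mulr_sumr; apply: eq_bigr => i _; rewrite mxE mulrCA. Qed.

Lemma dotvZl {R : realType} {n : nat} (c : R) (x y : 'rV[R]_n) :
  dotv (c *: x) y = c * dotv x y.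
Proof. by rewrite !(dotvC _ y) dotvZr. Qed.

Lemma dotvNr {R : realType} {n : nat} (x y : 'rV[R]_n) :
  dotv x (- y) = - dotv x y.
Proof. by rewrite -scaleN1r dotvZr mulN1r. Qed.

Lemma dotvNl {R : realType} {n : nat} (x y : 'rV[R]_n) :
  dotv (- x) y = - dotv x y.
Proof. by rewrite !(dotvC _ y) dotvNr. Qed.

Definition dotvE := (@dotvDr, @dotvDl, @dotvNr, @dotvNl, @dotvZr, @dotvZl).

Lemma dotvv_ge0 {R : realType} {n : nat} (x : 'rV[R]_n) : 0 <= dotv x x.
Proof. by apply: sumr_ge0 => i _; rewrite -expr2 sqr_ge0. Qed.

Lemma enorm_ge0 {R : realType} {n : nat} (x : 'rV[R]_n) : 0 <= enorm x.
Proof. exact: sqrtr_ge0. Qed.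

Lemma enorm_sqr {R : realType} {n : nat} (x : 'rV[R]_n) :
  enorm x ^+ 2 = dotv x x.
Proof. by rewrite sqr_sqrtr // dotvv_ge0. Qed.

Lemma enorm0_eq0 {R : realType} {n : nat} (x : 'rV[R]_n) :
  enorm x = 0 -> x = 0.
Proof.
move=> x0; have /eqP : dotv x x = 0 by rewrite -enorm_sqr x0 expr0n.
rewrite psumr_eq0; last by move=> i _; rewrite -expr2 sqr_ge0.
move=> /allP xi0; apply/rowP => i; rewrite mxE.
by have := xi0 i (mem_index_enum _); rewrite /= mulf_eq0 orbb => /eqP.
Qed.

(** Cauchy-Schwarz: the vector [dotv y y *: x - dotv x y *: y] has nonnegative square, and dividing
    that square by [dotv y y] gives the claim. The division forces a separate case for [y] of norm
    zero. *)
Lemma dotv_le {R : realType} {n : nat} (x y : 'rV[R]_n) :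
  `|dotv x y| <= enorm x * enorm y.
Proof.
have [y0|yN0] := eqVneq (enorm y) 0.
  have -> : y = 0 *: y by rewrite (enorm0_eq0 _ y0) scaler0.
  by rewrite dotvZr mul0r normr0 mulr_ge0 // enorm_ge0.
have y_gt0 : 0 < dotv y y.
  by rewrite -enorm_sqr exprn_gt0 // lt_neqAle eq_sym yN0 enorm_ge0.
rewrite -(@ler_pXn2r _ 2) ?nnegrE ?mulr_ge0 ?enorm_ge0 //.
rewrite exprMn !enorm_sqr real_normK ?num_real //.
have := dotvv_ge0 (dotv y y *: x - dotv x y *: y).
rewrite !dotvE (dotvC y x) => h.
rewrite -subr_ge0 -(pmulr_rge0 _ y_gt0); apply: le_trans h _.
by rewrite le_eqVlt; apply/orP; left; apply/eqP; ring.
Qed.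

Lemma enormD {R : realType} {n : nat} (x y : 'rV[R]_n) :
  enorm (x + y) <= enorm x + enorm y.
Proof.
rewrite -(@ler_pXn2r _ 2) ?nnegrE ?addr_ge0 ?enorm_ge0 //.
rewrite sqrrD !enorm_sqr !dotvE (dotvC y x).
have := le_trans (ler_norm _) (dotv_le x y); lra.
Qed.

Lemma enormZ {R : realType} {n : nat} (c : R) (x : 'rV[R]_n) :
  enorm (c *: x) = `|c| * enorm x.
Proof. by rewrite /enorm !dotvE mulrA -expr2 sqrtrM ?sqr_ge0 // sqrtr_sqr. Qed.

Lemma enormN {R : realType} {n : nat} (x : 'rV[R]_n) : enorm (- x) = enorm x.
Proof. by rewrite -scaleN1r enormZ normrN1 mul1r. Qed.

Lemma enorm0 {R : realType} {n : nat} : enorm (0 : 'rV[R]_n) = 0.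
Proof. by rewrite -(scale0r 0) enormZ normr0 mul0r. Qed.

Lemma enormB {R : realType} {n : nat} (x y : 'rV[R]_n) :
  enorm (x - y) = enorm (y - x).
Proof. by rewrite -enormN opprB. Qed.

Lemma ler_enormB {R : realType} {n : nat} (x y : 'rV[R]_n) :
  `|enorm x - enorm y| <= enorm (x - y).
Proof.
rewrite ler_norml; have := enormD (x - y) y; rewrite subrK.
have := enormD (y - x) x; rewrite subrK (enormB y); lra.
Qed.

Lemma enorm_sum {R : realType} {n k : nat} (f : 'I_k -> 'rV[R]_n) :
  enorm (\sum_(i < k) f i) <= \sum_(i < k) enorm (f i).
Proof.
elim/big_rec2: _ => [|i y x _ le_xy]; first by rewrite enorm0.
exact: le_trans (enormD _ _) (lerD _ _).
Qed.

Lemma coord_le_enorm {R : realType} {n : nat} (x : 'rV[R]_n) (i : 'I_n) :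
  `|x 0 i| <= enorm x.
Proof.
rewrite -(@ler_pXn2r _ 2) ?nnegrE ?enorm_ge0 // enorm_sqr real_normK ?num_real //.
rewrite /dotv (bigD1 i) //= -expr2 lerDl.
by apply: sumr_ge0 => j _; rewrite -expr2 sqr_ge0.
Qed.

Lemma enorm_le_sum {R : realType} {n : nat} (x : 'rV[R]_n) :
  enorm x <= \sum_(i < n) `|x 0 i|.
Proof.
rewrite [X in enorm X]row_sum_delta; apply: le_trans (enorm_sum _) _.
apply: ler_sum => i _; rewrite enormZ -[leRHS]mulr1 ler_wpM2l //.
rewrite /enorm /dotv (bigD1 i) //= big1 => [|j ji].
  by rewrite !mxE !eqxx mulr1 addr0 sqrtr1.
by rewrite !mxE (negPf ji) mulr0.
Qed.

Lemma enorm_mulmx {R : realType} {m n : nat} (A : 'M[R]_(m, n)) :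
  exists2 c : R, 1 <= c & forall x : 'rV[R]_m, enorm (x *m A) <= c * enorm x.
Proof.
exists (1 + \sum_(j < n) \sum_(i < m) `|A i j|).
  by rewrite lerDl; apply: sumr_ge0 => j _; apply: sumr_ge0.
move=> x; rewrite mulrDl mul1r mulr_suml.
apply: le_trans (enorm_le_sum _) _; rewrite -[leLHS]add0r.
apply: lerD; first exact: enorm_ge0.
apply: ler_sum => j _; rewrite mxE mulr_suml.
apply: le_trans (ler_norm_sum _ _ _) _; apply: ler_sum => i _.
by rewrite normrM mulrC ler_wpM2l // coord_le_enorm.
Qed.

(** * Continuity, compactness and convexity *)

(** The topology comes from the sup norm, and the Euclidean norm is at most [n] times it. The radius
    uses [n.+1] and [|L| + 1] to keep the divisor positive when [n] is 0 or [L] is not positive. *)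
Lemma lipschitz_continuous {R : realType} {n : nat} {f : 'rV[R]_n -> R} {L : R} :
  (forall x y, `|f x - f y| <= L * enorm (x - y)) -> continuous f.
Proof.
move=> fL x; apply/(cvgrPdist_le (FF := nbhs_filter x)) => e e0.
apply/nbhs_ballP.
have c0 : 0 < (`|L| + 1) * n.+1%:R by rewrite mulr_gt0 // ltr_pwDr.
exists (e / ((`|L| + 1) * n.+1%:R)); first by rewrite /= divr_gt0.
move=> y xy; apply: le_trans (fL x y) _.
apply: (@le_trans _ _ ((`|L| + 1) * \sum_(i < n) `|(x - y) 0 i|)).
  apply: (@le_trans _ _ ((`|L| + 1) * enorm (x - y))).
    by rewrite ler_wpM2r ?enorm_ge0 // (le_trans (ler_norm _)) // lerDl.
  by rewrite ler_wpM2l ?enorm_le_sum // addr_ge0.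
rewrite mulrC -ler_pdivlMr ?ltr_pwDr //.
apply: (@le_trans _ _ (\sum_(i < n) e / ((`|L| + 1) * n.+1%:R))).
  by apply: ler_sum => i _; rewrite !mxE; apply: ltW; case: xy => _ /(_ 0 i).
rewrite sumr_const card_ord -[leLHS]mulr_natr invfM mulrA -[leLHS]mulrA.
rewrite ler_piMr ?divr_ge0 ?addr_ge0 ?(ltW e0) //.
by rewrite mulrC ler_pdivrMr // mul1r ler_nat.
Qed.

Lemma dotv_continuous {R : realType} {n : nat} (p : 'rV[R]_n) :
  continuous (dotv p).
Proof.
apply: (@lipschitz_continuous _ _ _ (enorm p)) => x y.
by rewrite -dotvNr -dotvDr dotv_le.
Qed.

Lemma enormB_continuous {R : realType} {n : nat} (c : R) (p : 'rV[R]_n) :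
  continuous (fun x : 'rV[R]_n => enorm (p - c *: x)).
Proof.
apply: (@lipschitz_continuous _ _ _ `|c|) => x y; rewrite -enormZ.
apply: le_trans (ler_enormB _ _) _.
by rewrite opprB addrC addrA subrK -scalerBr !enormZ enormB.
Qed.

Lemma bcc_argmax {R : realType} {n : nat} {G : set 'rV[R]_n} {f : 'rV[R]_n -> R} :
  bounded_convex_closed G -> continuous f ->
  exists2 q, G q & forall t, G t -> f t <= f q.
Proof.
case=> G0 Gb _ Gc fc.
have [|q /set_mem Gq fq] :=
  EVT_max_rV G0 (bounded_closed_compact Gb Gc) (f := f).
  exact: continuous_subspaceT.
by exists q => // t Gt; apply: fq; rewrite inE.
Qed.

Lemma bcc_argmin {R : realType} {n : nat} {G : set 'rV[R]_n} {f : 'rV[R]_n -> R} :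
  bounded_convex_closed G -> continuous f ->
  exists2 q, G q & forall t, G t -> f q <= f t.
Proof.
case=> G0 Gb _ Gc fc.
have [|q /set_mem Gq fq] :=
  EVT_min_rV G0 (bounded_closed_compact Gb Gc) (f := f).
  exact: continuous_subspaceT.
by exists q => // t Gt; apply: fq; rewrite inE.
Qed.

(** [bounded_set] refers to the sup norm; maximizing the Euclidean norm over the compact set [G]
    gives a bound in the norm of the estimates. *)
Lemma bcc_enorm_bound {R : realType} {n : nat} {G : set 'rV[R]_n} :
  bounded_convex_closed G ->
  exists2 r : R, 0 <= r & forall q, G q -> enorm q <= r.
Proof.
move=> bG; have [|q Gq qmax] := bcc_argmax (f := @enorm R n) bG.
  by apply: (@lipschitz_continuous _ _ _ 1) => x y; rewrite mul1r ler_enormB.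
by exists (enorm q); [exact: enorm_ge0|].
Qed.

Lemma convex_setE {R : realType} {n : nat} {G : set 'rV[R]_n} :
  convex_set G <-> forall x y t, G x -> G y -> 0 <= t <= 1 ->
    G (t *: x + (1 - t) *: y).
Proof.
split=> [cG x y t Gx Gy t01|cG x y l /set_mem Gx /set_mem Gy].
  case/andP: t01 => t0 t1.
  have /= := cG x y (Itv01 t0 t1) (mem_set Gx) (mem_set Gy).
  by rewrite inE.
by rewrite inE; apply: cG => //; rewrite ge0 le1.
Qed.

(** This is where convexity enters the upper bound: the sum is [k.+1] times the convex combination
    of [x] and [y] with weights [k / (k + 1)] and [1 / (k + 1)]. *)
Lemma bcc_scaled_sum {R : realType} {n : nat} {G : set 'rV[R]_n} {x y : 'rV[R]_n}
    (k : nat) :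
  bounded_convex_closed G -> G x -> G y ->
  exists2 z, G z & k%:R *: x + y = k.+1%:R *: z.
Proof.
case=> _ _ /convex_setE cG _ Gx Gy.
have k0 : k.+1%:R != 0 :> R by rewrite pnatr_eq0.
exists ((k%:R / k.+1%:R) *: x + (1 - k%:R / k.+1%:R) *: y).
  apply: cG => //; rewrite divr_ge0 //= ler_pdivrMr ?ltr0n // mul1r ler_nat.
  exact: leqnSn.
rewrite scalerDr !scalerA mulrBr mulr1 mulrCA divff // mulr1.
by rewrite -[in X in X - _]addn1 natrD addrAC subrr add0r scale1r.
Qed.

(** * Sublinear functions and the convex sets that they support *)

Lemma sublinear_fun_ge {R : realType} {d : nat} {g : 'rV[R]_d -> R} (x y : 'rV[R]_d) :
  sublinear_fun g -> g x - g (- y) <= g (x + y).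
Proof. by case=> /(_ (x + y) (- y)) + _; rewrite addrK; lra. Qed.

Lemma sublinear_fun0 {R : realType} {d : nat} {g : 'rV[R]_d -> R} :
  sublinear_fun g -> g 0 = 0.
Proof. by case=> _ /(_ 0 0 (lexx _)); rewrite scaler0 mul0r. Qed.

Lemma sublinear_fun_sum {R : realType} {d n : nat} {g : 'rV[R]_d -> R}
    (f : 'I_n -> 'rV[R]_d) :
  sublinear_fun g -> g (\sum_(i < n) f i) <= \sum_(i < n) g (f i).
Proof.
move=> sg; elim/big_rec2: _ => [|i y x _ le_xy]; first by rewrite sublinear_fun0.
by apply: le_trans (sg.1 _ _) _; rewrite lerD2l.
Qed.

(* [h x = inf_(t >= 0) (g (x + t p) - t g p)] is linear along [p]; iterating over a
   basis yields a linear functional below [g], which replaces Hahn-Banach. *)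
Lemma sublinear_fun_flatten {R : realType} {d : nat} {g : 'rV[R]_d -> R} (p : 'rV[R]_d) :
  sublinear_fun g ->
  exists h, [/\ sublinear_fun h, forall x, h x <= g x & h (- p) <= - g p].
Proof.
move=> sg; have [gD gZ] := sg.
pose A x := [set g (x + t *: p) - t * g p | t in [set t : R | 0 <= t]].
(* Subadditivity along [t p = (t p + x) + (- x)] gives a bound free of [t], so the infimum is
   finite. *)
have A_lb x : lbound (A x) (- g (- x)).
  move=> _ [t /= t0 <-]; rewrite -gZ // (addrC x).
  by have := sublinear_fun_ge (t *: p) x sg; lra.
have A_inf x : has_inf (A x).
  by split; [exists (g (x + 0 *: p) - 0 * g p), 0 => //=|exists (- g (- x))].
have infA x t : 0 <= t -> inf (A x) <= g (x + t *: p) - t * g p.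
  by move=> t0; apply: (ge_inf (A_inf x).2); exists t.
exists (fun x => inf (A x)); split=> [|x|].
- split=> [x y|c x].
  + rewrite -lerBlDr; apply: lb_le_inf (A_inf x).1 _ => _ [s /= s0 <-].
    rewrite lerBlDr -lerBlDl; apply: lb_le_inf (A_inf y).1 _ => _ [t /= t0 <-].
    (* Competitors [s] for [x] and [t] for [y] combine into the competitor [s + t] for [x + y]. *)
    rewrite lerBlDl; apply: le_trans (infA _ (s + t) (addr_ge0 s0 t0)) _.
    rewrite scalerDl addrACA; have := gD (x + s *: p) (y + t *: p).
    rewrite mulrDl; lra.
  + rewrite le0r => /orP[/eqP->|c0].
      rewrite mul0r scale0r; apply/eqP; rewrite eq_le; apply/andP; split.
        have := infA 0 0 (lexx _).
        by rewrite scale0r addr0 (sublinear_fun0 sg) mul0r subrr.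
      apply: lb_le_inf (A_inf 0).1 _.
      by have := A_lb 0; rewrite oppr0 (sublinear_fun0 sg) oppr0.
    (* For [c > 0] the rescaling of [t] by [c] matches the competitors for [x] with those for
       [c *: x]. *)
    apply/eqP; rewrite eq_le; apply/andP; split.
      rewrite mulrC -ler_pdivrMr //; apply: lb_le_inf (A_inf x).1 _ => _ [t /= t0 <-].
      rewrite ler_pdivrMr // [leRHS]mulrC mulrBr -(gZ c) ?(ltW c0) // scalerDr scalerA mulrA.
      by apply: infA; rewrite mulr_ge0 // ltW.
    apply: lb_le_inf (A_inf _).1 _ => _ [t /= t0 <-].
    rewrite -(ler_pM2l (_ : 0 < c^-1)) ?invr_gt0 // mulKf ?gt_eqF //.
    rewrite mulrBr -(gZ c^-1) ?invr_ge0 ?(ltW c0) // scalerDr !scalerA mulVf ?gt_eqF //.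
    by rewrite scale1r mulrA; apply: infA; rewrite mulr_ge0 // invr_ge0 ltW.
- by have := infA x 0 (lexx _); rewrite scale0r addr0 mul0r subr0.
- have := infA (- p) 1 ler01.
  by rewrite scale1r addNr (sublinear_fun0 sg) mul1r sub0r.
Qed.

(** Flattening along [p] first pins the value at [p]: a linear functional below the result is at
    least [g p] there. Flattening along the basis vectors then leaves a linear functional, whose
    coordinates form [q]. *)
Lemma sublinear_fun_support {R : realType} {d : nat} {g : 'rV[R]_d -> R} (p : 'rV[R]_d) :
  sublinear_fun g ->
  exists q, dotv p q = g p /\ forall x, dotv x q <= g x.
Proof.
move=> sg.
(* The condition [h v + h (- v) <= 0] is linearity along [v]. It passes to every smaller function,
   so later flattenings do not destroy it. *)
have flat (s : seq 'rV[R]_d) g0 : sublinear_fun g0 ->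
    exists h, [/\ sublinear_fun h, forall x, h x <= g0 x &
      forall v, v \in s -> h v + h (- v) <= 0].
  move=> sg0; elim: s => [|v s [h [sh hg hs]]]; first by exists g0.
  have [h' [sh' h'h h'v]] := sublinear_fun_flatten v sh.
  exists h'; split=> // [x|u]; first exact: le_trans (h'h x) (hg x).
  rewrite inE => /orP[/eqP->|/hs].
    by have := h'h v; lra.
  by have := h'h u; have := h'h (- u); lra.
have [h0 [sh0 h0g h0p]] := sublinear_fun_flatten p sg.
have [h [sh hh0 hs]] :=
  flat [seq delta_mx 0 i | i <- enum 'I_d] h0 sh0.
pose q : 'rV[R]_d := \row_i h (delta_mx 0 i).
have h_le x : h x <= dotv x q.
  rewrite [X in h X]row_sum_delta; apply: le_trans (sublinear_fun_sum _ sh) _.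
  apply: ler_sum => i _; rewrite mxE.
  (* Homogeneity covers only nonnegative coordinates; for a negative one the sign moves onto the
     basis vector, and flatness compares the two directions. *)
  have [x0|x0] := leP 0 (x 0 i); first by rewrite sh.2.
  have -> : h (x 0 i *: delta_mx 0 i) = x 0 i * - h (- delta_mx 0 i).
    by rewrite mulrN -mulNr -sh.2 ?oppr_ge0 ?(ltW x0) // scaleNr scalerN opprK.
  apply: ler_wnM2l; first exact: ltW.
  rewrite -subr_le0 opprK.
  by apply: hs; apply/mapP; exists i; rewrite ?mem_enum.
(* A sublinear function below a linear one equals it: apply the bound at [- x] and use
   [- h (- x) <= h x]. *)
have h_eq x : h x = dotv x q.
  apply/eqP; rewrite eq_le h_le /=; have := h_le (- x); rewrite dotvNl.
  by have := sublinear_fun_ge 0 x sh; rewrite add0r (sublinear_fun0 sh); lra.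
exists q; split=> [|x]; last by rewrite -h_eq (le_trans (hh0 _)).
apply/eqP; rewrite eq_le -[X in X <= _]h_eq (le_trans (hh0 _)) //=.
by have := h_eq (- p); have := hh0 (- p); rewrite dotvNl; lra.
Qed.

(** The subdifferential of [g] at the origin, the candidate for [Gamma]. *)
Definition support_set {R : realType} {d : nat} (g : 'rV[R]_d -> R) : set 'rV[R]_d :=
  [set q | forall p, dotv p q <= g p].

Lemma support_set_bcc {R : realType} {d : nat} {g : 'rV[R]_d -> R} :
  sublinear_fun g -> bounded_convex_closed (support_set g).
Proof.
move=> sg; split.
- by have [q [_ qg]] := sublinear_fun_support 0 sg; exists q.
(* Testing [q] against plus and minus each basis vector bounds every coordinate, hence the sup
   norm. *)
- pose B := \sum_(i < d) (`|g (delta_mx 0 i)| + `|g (- delta_mx 0 i)|).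
  exists B; split; first exact: num_real.
  move=> M BM q /= qg; apply/ltW; apply: le_lt_trans BM.
  have B0 : 0 <= B by apply: sumr_ge0 => i _; rewrite addr_ge0.
  have [q0|/mx_norm_neq0[[i j] /= qij]] := eqVneq (mx_norm q) 0.
    by rewrite [leLHS]q0.
  rewrite [leLHS]qij ord1; apply: (@le_trans _ _ (`|g (delta_mx 0 j)| + `|g (- delta_mx 0 j)|)).
    have qj : dotv (delta_mx 0 j) q = q 0 j.
      rewrite /dotv (bigD1 j) //= big1 => [|k kj]; rewrite mxE eqxx.
        by rewrite eqxx mul1r addr0.
      by rewrite (negPf kj) mul0r.
    rewrite ler_norml; have := qg (delta_mx 0 j); have := qg (- delta_mx 0 j).
    rewrite dotvNl qj; have := ler_norm (g (delta_mx 0 j)).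
    have := ler_norm (g (- delta_mx 0 j)); have := normr_ge0 (g (delta_mx 0 j)).
    have := normr_ge0 (g (- delta_mx 0 j)); lra.
  by rewrite /B (bigD1 j) //= lerDl; apply: sumr_ge0 => i' _; rewrite addr_ge0.
- apply/convex_setE => x y t xg yg /andP[t0 t1] p.
  have -> : g p = t * g p + (1 - t) * g p by ring.
  by rewrite dotvDr !dotvZr lerD // ler_wpM2l ?subr_ge0.
- have -> : support_set g = \bigcap_(p in setT) (dotv p @^-1` [set y | y <= g p]).
    by apply/seteqP; split => [q qg p _|q qg p]; [exact: qg|exact: (qg p I)].
  apply: closed_bigI => p _; apply: preimage_closed; last exact: closed_le.
  by move=> x _; exact: dotv_continuous.
Qed.

Lemma represents_support {R : realType} {d : nat} {g : 'rV[R]_d -> R} {G : set 'rV[R]_d}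
    (p : 'rV[R]_d) :
  represents g G ->
  (exists2 q, G q & dotv p q = g p) /\ forall q, G q -> dotv p q <= g p.
Proof.
case=> bG gE; have [q Gq qmax] := bcc_argmax bG (dotv_continuous p).
suff -> : g p = dotv p q by split; [exists q|].
rewrite gE; apply/eqP; rewrite eq_le; apply/andP; split.
  by apply: ge_sup => [|_ [y Gy <-]]; [exists (dotv p q), q|exact: qmax].
by apply: ub_le_sup; [exists (dotv p q) => _ [y Gy <-]; exact: qmax|exists q].
Qed.

Lemma support_set_represents {R : realType} {d : nat} {g : 'rV[R]_d -> R} :
  sublinear_fun g -> represents g (support_set g).
Proof.
move=> sg; split=> [|p]; first exact: support_set_bcc.
have [q [qp qg]] := sublinear_fun_support p sg.
apply/eqP; rewrite eq_le; apply/andP; split.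
  by apply: ub_le_sup; [exists (g p) => _ [y yg <-]; exact: yg|exists q].
by apply: ge_sup => [|_ [y yg <-]]; [exists (g p), q|exact: yg].
Qed.

(** Project a point [z] of the support set to [q] in [G] and put [p = z - q]. A maximizer [q'] of
    [dotv p] on [G] satisfies [<p, z> <= g p = <p, q'>], so [|p|^2 <= <p, q' - q>], while optimality
    of the projection makes the right side nonpositive; thus [z = q]. *)
Lemma represents_unique {R : realType} {d : nat} {g : 'rV[R]_d -> R} {G : set 'rV[R]_d} :
  represents g G -> G = support_set g.
Proof.
move=> rG; have [bG _] := rG; apply/seteqP; split=> [q Gq p|z zg].
  exact: (represents_support p rG).2.
have [q Gq qmin] := bcc_argmin bG (enormB_continuous 1 z).
have [p pE] : exists p, p = z - q by exists (z - q).
have [[q' Gq' q'p] _] := represents_support p rG.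
have pp : dotv p p <= dotv p q' - dotv p q.
  by rewrite q'p [X in dotv _ X]pE dotvDr dotvNr lerB.
(* first-order optimality, on the segment from [q] to [q'], of the projection [q] of [z] *)
have opt t : 0 < t <= 1 -> 2 * (dotv p q' - dotv p q) <= t * dotv (q' - q) (q' - q).
  case/andP=> t0 t1.
  have Gt : G (t *: q' + (1 - t) *: q).
    by have [_ _ /convex_setE cG _] := bG; apply: cG; rewrite // ltW.
  have := qmin _ Gt; rewrite !scale1r.
  have -> : z - (t *: q' + (1 - t) *: q) = p - t *: (q' - q).
    by rewrite scalerBl scale1r scalerBr pE; apply/rowP => i; rewrite !mxE; ring.
  rewrite -pE -(@ler_pXn2r _ 2) ?nnegrE ?enorm_ge0 // !enorm_sqr => h.
  rewrite -(ler_pM2l t0); move: h.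
  by rewrite !dotvE (dotvC q' p) (dotvC q p) (dotvC q' q); lra.
have p0 : dotv p p <= 0.
  apply: le_trans pp _; rewrite leNgt; apply/negP => d0.
  move: d0 (dotvv_ge0 (q' - q)) opt.
  move: (dotv p q' - dotv p q) (dotv (q' - q) (q' - q)) => s D s0 D0.
  (* If [s > 0], the choice [t = s / (s + D)] is admissible even for [D = 0], and [opt] would give
     [2 (s + D) <= D]. *)
  have sD0 : 0 < s + D by rewrite ltr_pwDl.
  move=> /(_ (s / (s + D))); rewrite divr_gt0 //= ler_pdivrMr // mul1r lerDl.
  move=> /(_ D0); rewrite mulrAC ler_pdivlMr // -mulrA mulrCA ler_pM2l //; lra.
suff -> : z = q by [].
apply/eqP; rewrite -subr_eq0 -pE; apply/eqP; apply: enorm0_eq0.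
by apply/eqP; rewrite -sqrf_eq0 enorm_sqr eq_le p0 dotvv_ge0.
Qed.

(** * Test functions of quadratic growth *)

(** The case [m = 1] of [C_l_Lip]. It contains the squared distances of the argument and is stable
    under translation and under averaging over an increment. *)
Definition quad_Lip {R : realType} {n : nat} (F : 'rV[R]_n -> R) : Prop :=
  exists2 C : R, 0 <= C & forall x y : 'rV[R]_n,
    `|F x - F y| <= C * (1 + enorm x + enorm y) * enorm (x - y).

Lemma quad_Lip_lipschitz {R : realType} {n : nat} {F : 'rV[R]_n -> R} (L : R) :
  (forall x y, `|F x - F y| <= L * enorm (x - y)) -> quad_Lip F.
Proof.
move=> FL; exists `|L| => // x y; apply: le_trans (FL x y) _.
rewrite ler_wpM2r ?enorm_ge0 // (le_trans (ler_norm _)) // ler_peMr //.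
by rewrite -addrA lerDl addr_ge0 ?enorm_ge0.
Qed.

Lemma quad_Lip_sqr {R : realType} {n : nat} {f : 'rV[R]_n -> R} :
  (forall x y, `|f x - f y| <= enorm (x - y)) -> quad_Lip (fun x => f x ^+ 2).
Proof.
move=> f1; have fx x : `|f x| <= `|f 0| + enorm x.
  have := f1 x 0; rewrite subr0; have := ler_normD (f x - f 0) (f 0).
  rewrite subrK; lra.
exists (1 + 2 * `|f 0|); first by rewrite addr_ge0 // mulr_ge0.
move=> x y; rewrite subr_sqr normrM mulrC ler_pM //.
apply: le_trans (ler_normD _ _) _; have := fx x; have := fx y.
have : 0 <= `|f 0| * (enorm x + enorm y) by rewrite mulr_ge0 // addr_ge0 ?enorm_ge0.
have := enorm_ge0 x; have := enorm_ge0 y; lra.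
Qed.

Lemma quad_LipN {R : realType} {n : nat} {F : 'rV[R]_n -> R} :
  quad_Lip F -> quad_Lip (fun x => - F x).
Proof.
by case=> C C0 FC; exists C => // x y; rewrite -opprD normrN.
Qed.

(** Partial sums are linear images of the concatenated vector, so this makes functions of them
    admissible in the independence hypothesis. The constant [c >= 1] also absorbs the summand 1. *)
Lemma quad_Lip_mulmx {R : realType} {m n : nat} {F : 'rV[R]_n -> R} (A : 'M[R]_(m, n)) :
  quad_Lip F -> C_l_Lip (fun x => F (x *m A)).
Proof.
case=> C C0 FC; have [c c1 cA] := enorm_mulmx A.
have c0 : 0 < c by apply: lt_le_trans c1.
exists ((C + 1) * c * c); first by rewrite !mulr_gt0 // ltr_wpDl.
exists 1 => x y; rewrite !expr1; apply: le_trans (FC _ _) _.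
have -> : (C + 1) * c * c * (1 + enorm x + enorm y) * enorm (x - y) =
    (C + 1) * (c * (1 + enorm x + enorm y)) * (c * enorm (x - y)) by ring.
rewrite -mulmxBl; apply: ler_pM; rewrite ?mulr_ge0 ?addr_ge0 ?enorm_ge0 ?cA //.
apply: ler_pM; rewrite ?addr_ge0 ?enorm_ge0 ?lerDl //.
by have := cA x; have := cA y; lra.
Qed.

Lemma quad_Lip_shift {R : realType} {n : nat} {F : 'rV[R]_n -> R} (x : 'rV[R]_n) :
  quad_Lip F -> quad_Lip (fun y => F (x + y)).
Proof.
case=> C C0 FC; exists (C * (1 + 2 * enorm x)).
  by rewrite mulr_ge0 // addr_ge0 // mulr_ge0 // enorm_ge0.
move=> y z; apply: le_trans (FC _ _) _.
have -> : x + y - (x + z) = y - z by rewrite opprD addrACA subrr add0r.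
rewrite ler_wpM2r ?enorm_ge0 // -mulrA ler_wpM2l //.
have : 0 <= enorm x * (enorm y + enorm z) by rewrite mulr_ge0 ?addr_ge0 ?enorm_ge0.
have := enormD x y; have := enormD x z; have := enorm_ge0 y; have := enorm_ge0 z.
by lra.
Qed.

Lemma quad_Lip_C_l_Lip {R : realType} {n : nat} {F : 'rV[R]_n -> R} :
  quad_Lip F -> C_l_Lip F.
Proof.
by move=> /(quad_Lip_mulmx 1%:M) [C C0 [m Fm]]; exists C => //; exists m => x y;
  have := Fm x y; rewrite !mulmx1.
Qed.

Lemma enorm_quad_Lip {R : realType} {n : nat} : quad_Lip (@enorm R n).
Proof.
by apply: (@quad_Lip_lipschitz _ _ _ 1) => x y; rewrite mul1r ler_enormB.
Qed.

Lemma enorm_sqr_quad_Lip {R : realType} {n : nat} :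
  quad_Lip (fun x : 'rV[R]_n => enorm x ^+ 2).
Proof. exact: quad_Lip_sqr ler_enormB. Qed.

Lemma dotv_quad_Lip {R : realType} {n : nat} (p : 'rV[R]_n) :
  quad_Lip (fun x => dotv x p).
Proof.
apply: (@quad_Lip_lipschitz _ _ _ (enorm p)) => x y.
by rewrite -dotvNl -dotvDl mulrC dotv_le.
Qed.

Lemma random_vector_quad_Lip {R : realType} {Omega : Type} {H : set (Omega -> R)}
    {E : (Omega -> R) -> R} {n : nat} {X : Omega -> 'rV[R]_n} {F : 'rV[R]_n -> R} :
  sublinear_expectation_space H E -> random_vector H X -> quad_Lip F ->
  H (fun w => F (X w)).
Proof. by move=> hE hX hF; apply: (rvs_comp (ses_space hE)) (quad_Lip_C_l_Lip hF). Qed.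

(** * Sublinear expectations of functions of partial sums *)

(** Equality holds although [E] is only subadditive: the constant [- c] can be added back to get the
    reverse inequality. *)
Lemma expectation_affine {R : realType} {Omega : Type} {H : set (Omega -> R)}
    {E : (Omega -> R) -> R} (c b : R) {X : Omega -> R} :
  sublinear_expectation_space H E -> H X -> 0 <= b ->
  E (fun w => c + b * X w) = c + b * E X.
Proof.
move=> hE hX b0; have hH := ses_space hE.
have hc c' : H (fun=> c') := rvs_cst hH c'.
have hbX : H (fun w => b * X w) := rvs_scale hH b hX.
have hcbX : H (fun w => c + b * X w) := rvs_add hH (hc c) hbX.
rewrite -(ses_poshom hE b0 hX); apply/eqP; rewrite eq_le; apply/andP; split.
  by have := ses_subadd hE (hc c) hbX; rewrite (ses_cst hE).
have := ses_subadd hE (hc (- c)) hcbX; rewrite (ses_cst hE).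
by under eq_fun do rewrite addKr; lra.
Qed.

Lemma expectation_le_add {R : realType} {Omega : Type} {H : set (Omega -> R)}
    {E : (Omega -> R) -> R} {X Y Z : Omega -> R} :
  sublinear_expectation_space H E -> H X -> H Y -> H Z ->
  (forall w, X w <= Y w + Z w) -> E X <= E Y + E Z.
Proof.
move=> hE hX hY hZ XYZ; apply: le_trans (ses_subadd hE hY hZ).
by apply: (ses_mono hE) => //; apply: (rvs_add (ses_space hE)).
Qed.

Lemma expectation_dist {R : realType} {Omega : Type} {H : set (Omega -> R)}
    {E : (Omega -> R) -> R} {X Y Z : Omega -> R} :
  sublinear_expectation_space H E -> H X -> H Y -> H Z ->
  (forall w, `|X w - Y w| <= Z w) -> `|E X - E Y| <= E Z.
Proof.
move=> hE hX hY hZ XYZ; rewrite ler_distlC.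
have h1 : E X <= E Y + E Z.
  by apply: (expectation_le_add hE) => // w; have := XYZ w; rewrite ler_norml; lra.
have h2 : E Y <= E X + E Z.
  by apply: (expectation_le_add hE) => // w; have := XYZ w; rewrite ler_norml; lra.
lra.
Qed.

(** It places the inner expectation produced by independence back in [H], where monotonicity and
    subadditivity apply. The first moment of [Y] controls the growth constant. *)
Lemma quad_Lip_expectation {R : realType} {Omega : Type} {H : set (Omega -> R)}
    {E : (Omega -> R) -> R} {n : nat} {Y : Omega -> 'rV[R]_n} {F : 'rV[R]_n -> R} :
  sublinear_expectation_space H E -> random_vector H Y -> quad_Lip F ->
  quad_Lip (fun x => E (fun w => F (x + Y w))).
Proof.
move=> hE hY hF; have [C C0 FC] := hF; have hH := ses_space hE.
have hnY : H (fun w => enorm (Y w)) := random_vector_quad_Lip hE hY enorm_quad_Lip.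
pose m := E (fun w => enorm (Y w)).
have m0 : 0 <= m.
  rewrite -(ses_cst hE 0); apply: (ses_mono hE) => // [|w]; last exact: enorm_ge0.
  exact: (rvs_cst hH).
have hFx x : H (fun w => F (x + Y w)).
  exact: (random_vector_quad_Lip hE hY (quad_Lip_shift x hF)).
exists (C * (1 + 2 * m)); first by rewrite mulr_ge0 // addr_ge0 // mulr_ge0.
move=> x y; pose c := C * enorm (x - y).
have c0 : 0 <= c by rewrite mulr_ge0 // enorm_ge0.
apply: (@le_trans _ _ (E (fun w => c * (1 + enorm x + enorm y) + (c * 2) * enorm (Y w)))).
  apply: (expectation_dist hE) => // [|w].
    by apply: (rvs_add hH); [exact: (rvs_cst hH)|exact: (rvs_scale hH)].
  apply: le_trans (FC _ _) _.
  have -> : x + Y w - (y + Y w) = x - y by rewrite opprD addrACA subrr addr0.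
  rewrite mulrAC -/c -mulrA -mulrDr ler_wpM2l //.
  have := enormD x (Y w); have := enormD y (Y w); lra.
rewrite (expectation_affine _ _ hE hnY) ?mulr_ge0 ?enorm_ge0 // -/m.
have -> : C * (1 + 2 * m) * (1 + enorm x + enorm y) * enorm (x - y) =
    c * ((1 + 2 * m) * (1 + enorm x + enorm y)) by rewrite /c; ring.
rewrite -mulrA -mulrDr ler_wpM2l //.
have : 0 <= m * (enorm x + enorm y) by rewrite mulr_ge0 ?addr_ge0 ?enorm_ge0.
lra.
Qed.

Lemma random_vector_sum {R : realType} {Omega : Type} {H : set (Omega -> R)}
    {E : (Omega -> R) -> R} {d : nat} {Y : nat -> Omega -> 'rV[R]_d} (k : nat) :
  sublinear_expectation_space H E -> (forall i, random_vector H (Y i)) ->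
  random_vector H (fun w => \sum_(i < k) Y i w).
Proof.
move=> hE hY; have hH := ses_space hE; elim: k => [|k IH] j.
  under eq_fun do rewrite big_ord0 mxE.
  exact: (rvs_cst hH).
rewrite (_ : (fun w => _) = fun w => (\sum_(i < k) Y i w) 0 j + Y k w 0 j).
  by have := rvs_add hH (IH j) (hY k j).
by apply/funext => w; rewrite big_ord_recr mxE.
Qed.

Lemma concat_vectors_sum {R : realType} {Omega : Type} {d : nat}
    (Y : nat -> Omega -> 'rV[R]_d) (k : nat) (w : Omega) :
  concat_vectors Y k w *m lin_mul_row (const_mx 1 : 'rV_k) = \sum_(i < k) Y i w.
Proof.
rewrite mul_vec_lin_row; apply/rowP => j; rewrite mxE summxE.
by apply: eq_bigr => i _; rewrite !mxE mul1r.
Qed.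

Lemma expectation_sumS {R : realType} {Omega : Type} {H : set (Omega -> R)}
    {E : (Omega -> R) -> R} {d : nat} {Y : nat -> Omega -> 'rV[R]_d}
    {F : 'rV[R]_d -> R} (k : nat) :
  sublinear_expectation_space H E ->
  (forall i, independent_from E (Y i.+1) (concat_vectors Y i.+1)) ->
  quad_Lip F ->
  E (fun w => F (\sum_(i < k.+1) Y i w)) =
  E (fun w => E (fun w' => F (\sum_(i < k) Y i w + Y k w'))).
Proof.
move=> hE hI hF; under eq_fun do rewrite big_ord_recr /=.
(* Independence starts at the second vector. For [k = 0] the sum is zero and the outer expectation
   is that of a constant. *)
case: k => [|k].
  under [in RHS]eq_fun do under eq_fun do rewrite big_ord0.
  under [in LHS]eq_fun do rewrite big_ord0.
  by rewrite (ses_cst hE).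
(* [B] adds up the blocks of the concatenation, so [col_mx B 1%:M] sends past and new vector to
   their sum. *)
pose B : 'M[R]_(k.+1 * d, d) := lin_mul_row (const_mx 1 : 'rV_k.+1).
have BE w y : row_mx (concat_vectors Y k.+1 w) y *m col_mx B 1%:M =
    \sum_(i < k.+1) Y i w + y.
  by rewrite mul_row_col mulmx1 concat_vectors_sum.
have := hI k (fun z => F (z *m col_mx B 1%:M)) (quad_Lip_mulmx _ hF).
under eq_fun do rewrite BE.
move=> ->; congr E; apply/funext => w; congr E; apply/funext => w'.
by rewrite BE.
Qed.


(** * Distance to the dilated set, and the recursions for partial sums *)

Definition dil_dist {R : realType} {d : nat} (G : set 'rV[R]_d) (k : R)
    (x : 'rV[R]_d) : R :=
  inf [set enorm (x - k *: q) | q in G].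

Lemma dil_distP {R : realType} {d : nat} {G : set 'rV[R]_d} (k : R) (x : 'rV[R]_d) :
  bounded_convex_closed G ->
  exists2 q, G q & dil_dist G k x = enorm (x - k *: q).
Proof.
move=> bG; have [q Gq qmin] := bcc_argmin bG (enormB_continuous k x).
exists q => //; apply/eqP; rewrite eq_le; apply/andP; split.
  by apply: ge_inf; [exists (enorm (x - k *: q)) => _ [t Gt <-]; exact: qmin|exists q].
by apply: lb_le_inf => [|_ [t Gt <-]]; [exists (enorm (x - k *: q)), q|exact: qmin].
Qed.

Lemma dil_dist_le {R : realType} {d : nat} {G : set 'rV[R]_d} {q : 'rV[R]_d}
    (k : R) (x : 'rV[R]_d) :
  G q -> dil_dist G k x <= enorm (x - k *: q).
Proof.
by move=> Gq; apply: ge_inf; [exists 0 => _ [t Gt <-]; exact: enorm_ge0|exists q].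
Qed.

Lemma dil_dist_lipschitz {R : realType} {d : nat} {G : set 'rV[R]_d} (k : R)
    (x y : 'rV[R]_d) :
  bounded_convex_closed G -> `|dil_dist G k x - dil_dist G k y| <= enorm (x - y).
Proof.
move=> bG.
have le u v : dil_dist G k u <= dil_dist G k v + enorm (u - v).
  have [q Gq ->] := dil_distP k v bG; apply: le_trans (dil_dist_le k u Gq) _.
  have -> : u - k *: q = v - k *: q + (u - v).
    by rewrite [RHS]addrC addrA subrK.
  exact: enormD.
by rewrite ler_distlC; have := le x y; have := le y x; rewrite (enormB y); lra.
Qed.

(** Summing the increments and replacing each factor [k] by the final [n] leaves only the sum of the
    [a i]; the bound is o(n^2) when the averages of [a] tend to 0. *)
Lemma recursion_bound {R : realType} {u a : nat -> R} {K C : R} :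
  0 <= K -> (forall k, 0 <= a k) -> u 0%N <= 0 ->
  (forall k, u k.+1 <= u k + (C + 2 * a k * (K * k%:R))) ->
  forall n, u n <= C * n%:R + 2 * K * n%:R * \sum_(i < n) a i.
Proof.
move=> K0 a0 u0 uS; elim=> [|n IH]; first by rewrite !(mulr0, mul0r) addr0.
apply: le_trans (uS n) _; rewrite big_ord_recr /= -natr1.
have s0 : 0 <= \sum_(i < n) a i by exact: sumr_ge0.
have h1 : 0 <= K * (\sum_(i < n) a i) by rewrite mulr_ge0.
have h2 : 0 <= K * a n by rewrite mulr_ge0.
apply: le_trans (lerD IH (lexx _)) _; lra.
Qed.

Section SumEstimates.
Context {R : realType} {Omega : Type} {H : set (Omega -> R)}.
Context {E : (Omega -> R) -> R} (hE : sublinear_expectation_space H E).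
Context {d : nat} {Y : nat -> Omega -> 'rV[R]_d}.
Context (hY : forall i, random_vector H (Y i)).
Context (hI : forall i, independent_from E (Y i.+1) (concat_vectors Y i.+1)).
Local Notation S := (fun k w => \sum_(i < k) Y i w).

(** Independence turns a one-step estimate at each fixed [s] into one at the random [S k]; the error
    [N] stays under its own expectation. *)
Lemma sum_step_le (k : nat) (F F' N : 'rV[R]_d -> R) (a C : R) :
  quad_Lip F -> quad_Lip F' -> quad_Lip N -> 0 <= a ->
  (forall s, E (fun w => F' (s + Y k w)) <= F s + (C + a * N s)) ->
  E (fun w => F' (S k.+1 w)) <= E (fun w => F (S k w)) + (C + a * E (fun w => N (S k w))).
Proof.
move=> hF hF' hN a0 h; have hH := ses_space hE.
have hS := random_vector_sum k hE hY.
have hNS := random_vector_quad_Lip hE hS hN.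
rewrite (expectation_sumS k hE hI hF') -(expectation_affine _ _ hE hNS) //.
apply: (expectation_le_add hE) => //.
- exact: (random_vector_quad_Lip hE hS (quad_Lip_expectation hE (hY k) hF')).
- exact: random_vector_quad_Lip hE hS hF.
- by apply: (rvs_add hH); [exact: (rvs_cst hH)|exact: (rvs_scale hH)].
Qed.

Lemma sum_step_ge (k : nat) (F F' N : 'rV[R]_d -> R) (a C : R) :
  quad_Lip F -> quad_Lip F' -> quad_Lip N -> 0 <= a ->
  (forall s, F s <= E (fun w => F' (s + Y k w)) + (C + a * N s)) ->
  E (fun w => F (S k w)) <= E (fun w => F' (S k.+1 w)) + (C + a * E (fun w => N (S k w))).
Proof.
move=> hF hF' hN a0 h; have hH := ses_space hE.
have hS := random_vector_sum k hE hY.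
have hNS := random_vector_quad_Lip hE hS hN.
rewrite (expectation_sumS k hE hI hF') -(expectation_affine _ _ hE hNS) //.
apply: (expectation_le_add hE) => //.
- exact: random_vector_quad_Lip hE hS hF.
- exact: (random_vector_quad_Lip hE hS (quad_Lip_expectation hE (hY k) hF')).
- by apply: (rvs_add hH); [exact: (rvs_cst hH)|exact: (rvs_scale hH)].
Qed.

Context {M : R} (hM : forall i, E (fun w => enorm (Y i w) ^+ 2) <= M).

Lemma expectation_enorm_le (k : nat) : E (fun w => enorm (Y k w)) <= 1 + M.
Proof.
have hH := ses_space hE.
have h2 := random_vector_quad_Lip hE (hY k) enorm_sqr_quad_Lip.
have h1 := random_vector_quad_Lip hE (hY k) enorm_quad_Lip.
apply: (@le_trans _ _ (1 + E (fun w => enorm (Y k w) ^+ 2))); last by rewrite lerD2l.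
rewrite -[X in X + _](ses_cst hE); apply: (expectation_le_add hE) => // [|w].
  exact: (rvs_cst hH).
have := sqr_ge0 (enorm (Y k w) - 1); have := sqr_ge0 (enorm (Y k w)).
rewrite sqrrB1; lra.
Qed.

Lemma expectation_enorm_sum_le (k : nat) :
  E (fun w => enorm (S k w)) <= (1 + M) * k%:R.
Proof.
elim: k => [|k IH].
  by under eq_fun do rewrite big_ord0 enorm0; rewrite (ses_cst hE) mulr0.
rewrite -natr1 mulrDr mulr1.
apply: le_trans (lerD IH (expectation_enorm_le k)).
apply: (expectation_le_add hE) => [|||w].
- exact: (random_vector_quad_Lip hE (random_vector_sum k.+1 hE hY) enorm_quad_Lip).
- exact: (random_vector_quad_Lip hE (random_vector_sum k hE hY) enorm_quad_Lip).
- exact: (random_vector_quad_Lip hE (hY k) enorm_quad_Lip).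
- by rewrite big_ord_recr; exact: enormD.
Qed.

(** From [N (S k) <= N 0 + |S k|]. It supplies the linear growth that [recursion_bound] asks of the
    error term. *)
Lemma expectation_sum_lipschitz_le (k : nat) (N : 'rV[R]_d -> R) (r : R) :
  (forall x y, `|N x - N y| <= enorm (x - y)) -> N 0 <= k%:R * r ->
  E (fun w => N (S k w)) <= (1 + M + r) * k%:R.
Proof.
move=> N1 N0; have hH := ses_space hE; have hS := random_vector_sum k hE hY.
have -> : (1 + M + r) * k%:R = k%:R * r + (1 + M) * k%:R by ring.
apply: (@le_trans _ _ (k%:R * r + E (fun w => enorm (S k w)))); last first.
  by rewrite lerD2l expectation_enorm_sum_le.
rewrite -[X in X + _](ses_cst hE); apply: (expectation_le_add hE) => [|||w].
- apply: (random_vector_quad_Lip hE hS); apply: (@quad_Lip_lipschitz _ _ _ 1) => x y.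
  by rewrite mul1r.
- exact: (rvs_cst hH).
- exact: (random_vector_quad_Lip hE hS enorm_quad_Lip).
- by have := N1 (S k w) 0; rewrite subr0 ler_norml; lra.
Qed.

Context {a : nat -> R} {g : 'rV[R]_d -> R} {G : set 'rV[R]_d} {r : R}.
Context (ha : forall n, 0 < a n) (hG : represents g G) (r0 : 0 <= r).
Context (hr : forall q, G q -> enorm q <= r).
Context (hga : forall n p, `|E (fun w => dotv (Y n w) p) - g p| <= a n * enorm p).

(** The value of [recursion_bound] at [C = 2 r^2 + 2 M] and [K = 1 + M + r], shared by both
    bounds. *)
Let rem (n : nat) : R :=
  (2 * r ^+ 2 + 2 * M) * n%:R + 2 * (1 + M + r) * n%:R * \sum_(i < n) a i.

Let M0 : 0 <= M.
Proof.
apply: le_trans (hM 0); rewrite -{1}(ses_cst hE 0); apply: (ses_mono hE) => [||w].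
- exact: (random_vector_quad_Lip hE (hY 0) enorm_sqr_quad_Lip).
- exact: (rvs_cst (ses_space hE)).
- exact: sqr_ge0.
Qed.

(** Parallelogram identity, dropping [|y + q|^2]. *)
Let enormB_sqr_le (y q : 'rV[R]_d) :
  G q -> enorm (y - q) ^+ 2 <= 2 * enorm y ^+ 2 + 2 * r ^+ 2.
Proof.
move=> /hr qr; have : enorm q ^+ 2 <= r ^+ 2 by rewrite ler_pXn2r ?nnegrE ?enorm_ge0.
have := sqr_ge0 (enorm (y + q)); rewrite !enorm_sqr !dotvE (dotvC q y); lra.
Qed.

Lemma dil_dist_expectation_le (n : nat) :
  E (fun w => dil_dist G n%:R (S n w) ^+ 2) <= rem n.
Proof.
have [bG _] := hG; have hH := ses_space hE.
have dL k : quad_Lip (fun x => dil_dist G k x ^+ 2).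
  by apply: quad_Lip_sqr => x y; exact: dil_dist_lipschitz.
have [q0 Gq0] : G !=set0 by case: bG.
apply: (recursion_bound (u := fun n => E (fun w => dil_dist G n%:R (S n w) ^+ 2))).
- by rewrite !addr_ge0.
- by move=> k; apply: ltW.
- under eq_fun do rewrite big_ord0; rewrite (ses_cst hE).
  have [q _ ->] := dil_distP 0 0 bG.
  by rewrite scale0r subr0 enorm0 expr0n.
move=> k; have := sum_step_le k (fun s => dil_dist G k%:R s ^+ 2)
  (fun s => dil_dist G k.+1%:R s ^+ 2) (dil_dist G k%:R) (2 * a k) (2 * r ^+ 2 + 2 * M).
move=> /(_ (dL _) (dL _)) step; apply: le_trans (step _ _ _) _.
- by apply: (@quad_Lip_lipschitz _ _ _ 1) => x y; rewrite mul1r dil_dist_lipschitz.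
- by rewrite mulr_ge0 // ltW.
- move=> s; have [P GP dP] := dil_distP k%:R s bG.
  have [p pE] : exists p, p = s - k%:R *: P by exists (s - k%:R *: P).
  have [[q Gq qp] _] := represents_support p hG.
  rewrite dP -pE enorm_sqr.
  have hYp := random_vector_quad_Lip hE (hY k) (dotv_quad_Lip p).
  have hYY := random_vector_quad_Lip hE (hY k) enorm_sqr_quad_Lip.
  (* The part linear in [Y k] is kept apart from the quadratic one: its expectation cancels [2 g p]
     up to [2 a_k |p|], while the quadratic part is bounded by [2 M]. *)
  apply: (@le_trans _ _ (E (fun w => (dotv p p - 2 * g p + 2 * r ^+ 2) + 2 * dotv (Y k w) p) +
      E (fun w => 0 + 2 * enorm (Y k w) ^+ 2))).
    apply: (expectation_le_add hE) => [|||w].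
    - exact: random_vector_quad_Lip hE (hY k) (quad_Lip_shift s (dL _)).
    - by apply: (rvs_add hH); [exact: (rvs_cst hH)|exact: (rvs_scale hH)].
    - by apply: (rvs_add hH); [exact: (rvs_cst hH)|exact: (rvs_scale hH)].
    have [z Gz zE] := bcc_scaled_sum k bG GP Gq.
    apply: (@le_trans _ _ (enorm (p + (Y k w - q)) ^+ 2)).
      have d0 : 0 <= dil_dist G k.+1%:R (s + Y k w).
        by have [? _ ->] := dil_distP k.+1%:R (s + Y k w) bG; exact: enorm_ge0.
      rewrite ler_pXn2r ?nnegrE ?enorm_ge0 //.
      have -> : p + (Y k w - q) = s + Y k w - k.+1%:R *: z.
        by rewrite -zE pE opprD addrACA.
      exact: dil_dist_le.
    have := enormB_sqr_le (Y k w) q Gq.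
    rewrite -qp !enorm_sqr !dotvE.
    rewrite (dotvC q p) (dotvC (Y k w) p) (dotvC q (Y k w)); lra.
  rewrite (expectation_affine _ _ hE hYp) // (expectation_affine _ _ hE hYY) //.
  by have := hga k p; have := hM k; rewrite ler_norml; lra.
rewrite lerD2l lerD2l ler_wpM2l ?mulr_ge0 ?(ltW (ha k)) //.
apply: expectation_sum_lipschitz_le => [x y|]; first exact: dil_dist_lipschitz.
apply: le_trans (dil_dist_le k%:R 0 Gq0) _.
by rewrite sub0r enormN enormZ normr_nat ler_wpM2l ?hr.
Qed.

(** Here [- E (- X)] is the lower expectation. Only the lower expectation of the squared distance to
    a single point [n q] is small; the upper one need not be. *)
Lemma enormB_expectation_ge (n : nat) (q : 'rV[R]_d) : G q ->
  - E (fun w => - enorm (S n w - n%:R *: q) ^+ 2) <= rem n.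
Proof.
move=> Gq; have hH := ses_space hE.
have lip k x y : `|enorm (x - k *: q) - enorm (y - k *: q)| <= enorm (x - y).
  apply: le_trans (ler_enormB _ _) _.
  by rewrite opprB addrA subrK lexx.
have dL k : quad_Lip (fun x => - enorm (x - k *: q) ^+ 2).
  by apply: quad_LipN; exact: quad_Lip_sqr.
apply: (recursion_bound (u := fun n => - E (fun w => - enorm (S n w - n%:R *: q) ^+ 2))).
- by rewrite !addr_ge0.
- by move=> k; apply: ltW.
- under eq_fun do rewrite big_ord0 scale0r subr0 enorm0 expr0n oppr0.
  by rewrite (ses_cst hE) oppr0.
move=> k; have := sum_step_ge k (fun s => - enorm (s - k%:R *: q) ^+ 2)
  (fun s => - enorm (s - k.+1%:R *: q) ^+ 2) (fun s => enorm (s - k%:R *: q)) (2 * a k)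
  (2 * r ^+ 2 + 2 * M).
move=> /(_ (dL _) (dL _)) step.
rewrite lerNl opprD opprK lerBlDr; apply: le_trans (step _ _ _) _.
- by apply: (@quad_Lip_lipschitz _ _ _ 1) => x y; rewrite mul1r.
- by rewrite mulr_ge0 // ltW.
- move=> s.
  have [z zE] : exists z, z = s - k%:R *: q by exists (s - k%:R *: q).
  rewrite -zE enorm_sqr.
  have hYz := random_vector_quad_Lip hE (hY k) (dotv_quad_Lip (- z)).
  have hYY := random_vector_quad_Lip hE (hY k) enorm_sqr_quad_Lip.
  have : E (fun w => (- dotv z z + 2 * dotv z q - 2 * r ^+ 2) + 2 * dotv (Y k w) (- z)) <=
      E (fun w => - enorm (s + Y k w - k.+1%:R *: q) ^+ 2) +
      E (fun w => 0 + 2 * enorm (Y k w) ^+ 2).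
    apply: (expectation_le_add hE) => [|||w].
    - by apply: (rvs_add hH); [exact: (rvs_cst hH)|exact: (rvs_scale hH)].
    - exact: random_vector_quad_Lip hE (hY k) (quad_Lip_shift s (dL _)).
    - by apply: (rvs_add hH); [exact: (rvs_cst hH)|exact: (rvs_scale hH)].
    have -> : s + Y k w - k.+1%:R *: q = z + (Y k w - q).
      by rewrite zE -natr1 scalerDl scale1r opprD addrACA.
    have := enormB_sqr_le (Y k w) q Gq.
    rewrite !enorm_sqr !dotvE (dotvC q z) (dotvC (Y k w) z) (dotvC q (Y k w)); lra.
  rewrite (expectation_affine _ _ hE hYz) // (expectation_affine _ _ hE hYY) //.
  (* Since [q] lies in [G], [g (- z) >= - <z, q>], which cancels the term [2 <z, q>] up to
     [2 a_k |z|]. *)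
  have := hga k (- z); have := hM k; have := (represents_support (- z) hG).2 _ Gq.
  by rewrite ler_norml enormN dotvNl; lra.
rewrite lerD2l lerD2l ler_wpM2l ?mulr_ge0 ?(ltW (ha k)) //.
apply: (expectation_sum_lipschitz_le k (fun s => enorm (s - k%:R *: q))); first exact: lip.
by rewrite sub0r enormN enormZ normr_nat ler_wpM2l ?hr.
Qed.

End SumEstimates.

(** * Quantitative convergence of the means and the limit theorem *)

(** The Lipschitz error [L u] is traded for [L e + (L / e) u^2], so that the two bounds on squared
    distances apply; [e] remains free to be tuned. *)
Lemma expectation_mean_dist {R : realType} {Omega : Type} {H : set (Omega -> R)}
    {E : (Omega -> R) -> R} {d : nat} {Y : nat -> Omega -> 'rV[R]_d} {M r L e : R}
    {a : nat -> R} {g : 'rV[R]_d -> R} {G : set 'rV[R]_d} {phi : 'rV[R]_d -> R}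
    {q : 'rV[R]_d} (n : nat) :
  sublinear_expectation_space H E -> (forall i, random_vector H (Y i)) ->
  (forall i, independent_from E (Y i.+1) (concat_vectors Y i.+1)) ->
  (forall i, E (fun w => enorm (Y i w) ^+ 2) <= M) -> (forall n, 0 < a n) ->
  represents g G -> 0 <= r -> (forall q, G q -> enorm q <= r) ->
  (forall n p, `|E (fun w => dotv (Y n w) p) - g p| <= a n * enorm p) ->
  0 < L -> (forall x y, `|phi x - phi y| <= L * enorm (x - y)) ->
  G q -> (forall t, G t -> phi t <= phi q) -> 0 < e ->
  `|E (fun w => phi (n.+1%:R^-1 *: \sum_(i < n.+1) Y i w)) - phi q| <=
  L * e + L / e * ((2 * r ^+ 2 + 2 * M) / n.+1%:R +
    2 * (1 + M + r) * ((\sum_(i < n.+1) a i) / n.+1%:R)).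
Proof.
move=> hE hY hI hM ha hG r0 hr hga L0 phiL Gq qmax e0.
have hH := ses_space hE; have [bG _] := hG.
have hS := random_vector_sum n.+1 hE hY.
have up := dil_dist_expectation_le hE hY hI hM ha hG r0 hr hga n.+1.
have lo := enormB_expectation_ge hE hY hI hM ha hG r0 hr hga n.+1 q Gq.
set rem := (X in _ <= X) in up lo.
pose m : R := n.+1%:R; have m0 : 0 < m by rewrite ltr0n.
have mV0 : m^-1 != 0 by rewrite invr_neq0 ?gt_eqF.
pose b := L / e / m ^+ 2.
have b0 : 0 <= b by rewrite !divr_ge0 ?exprn_ge0 // ltW.
have -> : L / e * ((2 * r ^+ 2 + 2 * M) / n.+1%:R +
    2 * (1 + M + r) * ((\sum_(i < n.+1) a i) / n.+1%:R)) = b * rem.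
  by rewrite /b /rem -/m; field; rewrite !gt_eqF.
have amgm t : 0 <= t -> L * (m^-1 * t) <= L * e + b * t ^+ 2.
  move=> t0; have := sqr_ge0 (m^-1 * t - e).
  have u0 : 0 <= m^-1 * t by rewrite mulr_ge0 // invr_ge0 ltW.
  have -> : b * t ^+ 2 = L * ((m^-1 * t) ^+ 2 / e).
    by rewrite /b; field; rewrite !gt_eqF.
  move: (m^-1 * t) u0 => u u0 h; rewrite -mulrDr ler_pM2l //.
  rewrite -(ler_pM2r e0) mulrDl divfK ?gt_eqF //.
  have : 0 <= u * e by rewrite mulr_ge0 // ltW.
  by lra.
have scaled x t : enorm (m^-1 *: x - t) = m^-1 * enorm (x - m *: t).
  rewrite -[in RHS](ger0_norm (_ : 0 <= m^-1)) ?invr_ge0 ?ltW // -enormZ.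
  by rewrite scalerBr scalerA mulVf ?gt_eqF // scale1r.
have hphi : H (fun w => phi (m^-1 *: \sum_(i < n.+1) Y i w)).
  apply: (random_vector_quad_Lip (F := fun x => phi (m^-1 *: x)) hE hS).
  apply: (@quad_Lip_lipschitz _ _ _ (L * m^-1)) => x y.
  apply: le_trans (phiL _ _) _.
  by rewrite -scalerBr enormZ ger0_norm ?mulrA // invr_ge0 ltW.
rewrite ler_distl; apply/andP; split.
(* Lower side: compare [phi] at the mean with its value at the maximizer [q]. *)
- have hsq : H (fun w => - enorm (\sum_(i < n.+1) Y i w - m *: q) ^+ 2).
    apply: (random_vector_quad_Lip (F := fun x => - enorm (x - m *: q) ^+ 2) hE hS).
    apply: quad_LipN; apply: quad_Lip_sqr => x y; apply: le_trans (ler_enormB _ _) _.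
    by rewrite opprB addrA subrK lexx.
  apply: (@le_trans _ _ (E (fun w => (phi q - L * e) +
      b * (- enorm (\sum_(i < n.+1) Y i w - m *: q) ^+ 2)))).
    rewrite (expectation_affine _ _ hE hsq b0) opprD addrA lerD2l -mulrN ler_wpM2l //.
    by rewrite lerNl.
  apply: (ses_mono hE) => // [|w].
    by apply: (rvs_add hH); [exact: (rvs_cst hH)|exact: (rvs_scale hH)].
  have := amgm _ (enorm_ge0 (\sum_(i < n.+1) Y i w - m *: q)); rewrite -scaled.
  by have := phiL (m^-1 *: \sum_(i < n.+1) Y i w) q; rewrite ler_norml; lra.
(* Upper side: compare with the point [t] of [G] for which [m *: t] is nearest to the sum, where
   [phi t <= phi q]. *)
- have hd : H (fun w => dil_dist G m (\sum_(i < n.+1) Y i w) ^+ 2).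
    apply: (random_vector_quad_Lip (F := fun x => dil_dist G m x ^+ 2) hE hS).
    by apply: quad_Lip_sqr => x y; exact: dil_dist_lipschitz.
  apply: (@le_trans _ _ (E (fun w => (phi q + L * e) +
      b * dil_dist G m (\sum_(i < n.+1) Y i w) ^+ 2))); last first.
    by rewrite (expectation_affine _ _ hE hd b0) -addrA !lerD2l ler_wpM2l.
  apply: (ses_mono hE) => // [|w].
    by apply: (rvs_add hH); [exact: (rvs_cst hH)|exact: (rvs_scale hH)].
  have [t Gt ->] := dil_distP m (\sum_(i < n.+1) Y i w) bG.
  have := amgm _ (enorm_ge0 (\sum_(i < n.+1) Y i w - m *: t)); rewrite -scaled.
  have := qmax t Gt.
  by have := phiL (m^-1 *: \sum_(i < n.+1) Y i w) t; rewrite ler_norml; lra.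
Qed.

(* The sequences are indexed from 0: Y i and a i stand for Y_{i+1}, a_{i+1}. *)
Theorem theorem5p4 (R : realType) (Omega : Type) (H : set (Omega -> R))
    (E : (Omega -> R) -> R) (hE : sublinear_expectation_space H E)
    (d : nat) (Y : nat -> Omega -> 'rV[R]_d)
    (hY : forall i : nat, random_vector H (Y i))
    (hindep : forall i : nat,
      independent_from E (Y i.+1) (concat_vectors Y i.+1))
    (hM : exists2 M : R, 0 < M &
      forall i : nat, E (fun w => enorm (Y i w) ^+ 2) <= M)
    (a : nat -> R) (g : 'rV[R]_d -> R)
    (ha_pos : forall n : nat, 0 < a n)
    (hg : sublinear_fun g)
    (ha_mean : (fun n : nat => (\sum_(i < n) a i) / n%:R) @ \oo --> (0 : R))
    (hga : forall (n : nat) (p : 'rV[R]_d),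
      `|E (fun w => dotv (Y n w) p) - g p| <= a n * enorm p) :
  (exists! Gamma : set 'rV[R]_d, represents g Gamma) /\
  forall Gamma : set 'rV[R]_d, represents g Gamma ->
  forall (Omega' : Type) (H' : set (Omega' -> R)) (E' : (Omega' -> R) -> R)
    (eta : Omega' -> 'rV[R]_d),
    sublinear_expectation_space H' E' -> random_vector H' eta ->
    maximal_distributed E' Gamma eta ->
  forall phi : 'rV[R]_d -> R, C_b_Lip phi ->
    (fun n : nat => E (fun w => phi (n%:R^-1 *: \sum_(i < n) Y i w))) @ \oo
      --> E' (fun w => phi (eta w)).
Proof.
split.
  exists (support_set g); split; first exact: support_set_represents.
  by move=> G /represents_unique.
move=> G hG Omega' H' E' eta _ _ heta phi hphi.
(* The maximal distribution identifies the limit as [phi q] at a maximizer [q] of [phi] on [G]. *)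
have [[q Gq <-] qmax] := heta phi hphi.
have {}qmax t : G t -> phi t <= phi q by move=> Gt; apply: qmax; exists t.
have [_ [L0 phiL0]] := hphi.
pose L : R := `|L0| + 1; have L_gt0 : 0 < L by rewrite ltr_pwDr.
have phiL x y : `|phi x - phi y| <= L * enorm (x - y).
  apply: le_trans (phiL0 x y) _; rewrite ler_wpM2r ?enorm_ge0 //.
  by rewrite (le_trans (ler_norm _)) // lerDl.
have [M _ hM'] := hM; have [r r0 hr] := bcc_enorm_bound hG.1.
(* Passing to [n.+1] avoids the index 0, where the inverse has the default value 0. *)
rewrite -(cvg_shiftS (fun n : nat => E _)).
apply/cvgrPdist_le => eps eps0.
(* This choice makes [L * e] equal to [eps / 2]; with [e] fixed, the remaining [rate] tends to 0. *)
pose e : R := eps / (2 * L); have e0 : 0 < e by rewrite divr_gt0 // mulr_gt0.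
pose rate n : R := L / e * ((2 * r ^+ 2 + 2 * M) / n.+1%:R +
    2 * (1 + M + r) * ((\sum_(i < n.+1) a i) / n.+1%:R)).
have rate0 : rate n @[n --> \oo] --> (0 : R).
  have -> : (0 : R) = L / e * ((2 * r ^+ 2 + 2 * M) * 0 + 2 * (1 + M + r) * 0).
    by rewrite !mulr0 addr0 mulr0.
  apply: cvgMr; apply: cvgD; apply: cvgMr.
    exact: cvg_harmonic.
  by rewrite (cvg_shiftS (fun n => (\sum_(i < n) a i) / n%:R)).
move/cvgrPdist_le: rate0 => /(_ (eps / 2)); rewrite divr_gt0 // => /(_ isT).
apply: filterS => n; rewrite sub0r normrN => rate_n /=; rewrite distrC.
apply: le_trans (expectation_mean_dist n hE hY hindep hM' ha_pos hG r0 hr hga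
  L_gt0 phiL Gq qmax e0) _.
rewrite -/(rate n) [leRHS](splitr eps) lerD //.
  by rewrite /e le_eqVlt; apply/orP; left; apply/eqP; field; rewrite gt_eqF.
exact: le_trans (ler_norm _) rate_n.
Qed.
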